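(* Let $p\ge 1$ be an integer. The period of a Monge shuffle of $2^p$ cards is $p+1$. That is, with $n=2^{p-1}$, each of the four Monge shuffle permutations $h_1,h_2,h_3,h_4$ of $\{1,\dots,2n\}=\{1,\dots,2^p\}$ defined in the context has period $p+1$.
   Context: For $n\ge 1$ the Monge shuffles of $2n$ cards are described by the following permutations $h_1,h_2,h_3,h_4$ of $\{1,\dots,2n\}$ (or their inverses, which have the same periods): $h_1(i)=\frac{i+1}{2}+n$ if $i$ is odd, $h_1(i)=n+1-\frac{i}{2}$ if $i$ is even; $h_2(i)=\frac{i}{2}+n$ if $i$ is even, $h_2(i)=n-\frac{i-1}{2}$ if $i$ is odd; $h_3(i)=\frac{i}{2}$ if $i$ is even, $h_3(i)=2n-\frac{i-1}{2}$ if $i$ is odd; $h_4(i)=\frac{i+1}{2}$ if $i$ is odd, $h_4(i)=2n+1-\frac{i}{2}$ if $i$ is even. The period of a permutation $\sigma$ of a finite set is the smallest integer $r\ge 1$ such that $\sigma^r=\mathrm{id}$ ($r$-fold composition).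
   Formalization: For the shuffles h_2 and h_4 the period p+1 is claimed only for p ≥ 2, since for p = 1 both are the identity of {1,2}, with period 1 and not 2; h_1 and h_3 are covered for all p ≥ 1. *)

(* Defs.v *)
From mathcomp Require Import all_boot all_fingroup.
From mathcomp Require Import zify.
Set Implicit Arguments.
Unset Strict Implicit.
Unset Printing Implicit Defensive.

(* Truncated subtraction and halving are exact for 1 <= i <= 2 * n. *)
Definition monge1 (n i : nat) : nat :=
  if odd i then i.+1 %/ 2 + n else n + 1 - i %/ 2.
Definition monge2 (n i : nat) : nat :=
  if odd i then n - (i - 1) %/ 2 else i %/ 2 + n.
Definition monge3 (n i : nat) : nat :=
  if odd i then 2 * n - (i - 1) %/ 2 else i %/ 2.
Definition monge4 (n i : nat) : nat :=
  if odd i then i.+1 %/ 2 else 2 * n + 1 - i %/ 2.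

Section DeckPerm.

Variables (N : nat) (f : nat -> nat).
Hypothesis f_range : forall i, 1 <= i <= N -> 1 <= f i <= N.
Hypothesis f_inj :
  forall i j, 1 <= i <= N -> 1 <= j <= N -> f i = f j -> i = j.

Lemma deck_fun_subproof (i : 'I_N) : (f i.+1).-1 < N.
Proof. by have := f_range (i := i.+1); have := ltn_ord i; lia. Qed.

Definition deck_fun (i : 'I_N) : 'I_N := Ordinal (deck_fun_subproof i).

Lemma deck_fun_inj : injective deck_fun.
Proof.
move=> i j /(congr1 val) /= eq_f; apply: val_inj => /=.
have [li lj] := (ltn_ord i, ltn_ord j).
have := f_range (i := i.+1); have := f_range (i := j.+1).
have := f_inj (i := i.+1) (j := j.+1).
lia.
Qed.

(* The element k : 'I_N stands for the element k + 1 of {1, ..., N}, so this *)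
(* is f itself, viewed as a permutation of {1, ..., N}: see deck_permE.      *)
Definition deck_perm : {perm 'I_N} := perm deck_fun_inj.

Lemma deck_permE (i : 'I_N) : (deck_perm i).+1 = f i.+1.
Proof.
by rewrite permE /=; have := f_range (i := i.+1); have := ltn_ord i; lia.
Qed.

End DeckPerm.

Lemma monge1_range n i : 1 <= i <= 2 * n -> 1 <= monge1 n i <= 2 * n.
Proof. by rewrite /monge1; case: ifP; lia. Qed.
Lemma monge2_range n i : 1 <= i <= 2 * n -> 1 <= monge2 n i <= 2 * n.
Proof. by rewrite /monge2; case: ifP; lia. Qed.
Lemma monge3_range n i : 1 <= i <= 2 * n -> 1 <= monge3 n i <= 2 * n.
Proof. by rewrite /monge3; case: ifP; lia. Qed.
Lemma monge4_range n i : 1 <= i <= 2 * n -> 1 <= monge4 n i <= 2 * n.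
Proof. by rewrite /monge4; case: ifP; lia. Qed.

Lemma monge1_inj n i j : 1 <= i <= 2 * n -> 1 <= j <= 2 * n ->
  monge1 n i = monge1 n j -> i = j.
Proof. by rewrite /monge1; case: ifP; case: ifP; lia. Qed.
Lemma monge2_inj n i j : 1 <= i <= 2 * n -> 1 <= j <= 2 * n ->
  monge2 n i = monge2 n j -> i = j.
Proof. by rewrite /monge2; case: ifP; case: ifP; lia. Qed.
Lemma monge3_inj n i j : 1 <= i <= 2 * n -> 1 <= j <= 2 * n ->
  monge3 n i = monge3 n j -> i = j.
Proof. by rewrite /monge3; case: ifP; case: ifP; lia. Qed.
Lemma monge4_inj n i j : 1 <= i <= 2 * n -> 1 <= j <= 2 * n ->
  monge4 n i = monge4 n j -> i = j.
Proof. by rewrite /monge4; case: ifP; case: ifP; lia. Qed.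

Definition h1 (n : nat) : {perm 'I_(2 * n)} :=
  deck_perm (@monge1_range n) (@monge1_inj n).
Definition h2 (n : nat) : {perm 'I_(2 * n)} :=
  deck_perm (@monge2_range n) (@monge2_inj n).
Definition h3 (n : nat) : {perm 'I_(2 * n)} :=
  deck_perm (@monge3_range n) (@monge3_inj n).
Definition h4 (n : nat) : {perm 'I_(2 * n)} :=
  deck_perm (@monge4_range n) (@monge4_inj n).

Definition is_period (T : finType) (s : {perm T}) (r : nat) : Prop :=
  [/\ 1 <= r, (s ^+ r)%g = 1%g
    & forall m : nat, 1 <= m -> (s ^+ m)%g = 1%g -> r <= m].

(* Main.v *)
Require Import Defs.
From mathcomp Require Import all_boot all_fingroup.
From mathcomp Require Import ssralg ssrnum ssrint intdiv zify.
Set Implicit Arguments.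
Unset Strict Implicit.
Unset Printing Implicit Defensive.
Import GRing.Theory.

(** Let N = 2 ^ p.  Up to the choice of a coordinate c on the deck, the inverse
    of each Monge shuffle is the doubling map c |-> 2 c on the quotient of Z/M
    by the sign, with M = 2 N + 1 for h1 and h3, and M = 2 N - 1 for h2 and h4.
    Since 2 ^ (p + 1) = +-1 modulo M, the period divides p + 1; and for
    1 <= m <= p the number 2 ^ m is too small to be +-1 modulo M, so that the
    card of coordinate 1 is not fixed by the m-th power. *)

Definition eqpm (M : nat) (a b : int) : bool :=
  ((M %| a - b)%R || (M %| a + b)%R)%Z.

Lemma eqpm_trans M b a c : eqpm M a b -> eqpm M b c -> eqpm M a c.
Proof.
rewrite /eqpm => /orP[] /dvdzP[q1 e1] /orP[] /dvdzP[q2 e2]; apply/orP.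
- by left; apply/dvdzP; exists (q1 + q2)%R; lia.
- by right; apply/dvdzP; exists (q1 + q2)%R; lia.
- by right; apply/dvdzP; exists (q1 - q2)%R; lia.
- by left; apply/dvdzP; exists (q1 - q2)%R; lia.
Qed.

Lemma eqpm_mull M k a b : eqpm M a b -> eqpm M (k * a)%R (k * b)%R.
Proof.
rewrite /eqpm -mulrBr -mulrDr.
by case/orP => d; apply/orP; [left | right]; apply: dvdz_mull.
Qed.

(** Both [|a - b|] and [a + b] are smaller than [M], so whichever is a multiple of [M] must be 0. *)
Lemma eqpm_inj M (a b : nat) :
  2 * a < M -> 2 * b < M -> eqpm M a b -> a = b.
Proof.
move=> aM bM /orP[]; rewrite dvdzE.
- have [d0|d0] := posnP `|(a%:Z - b%:Z)%R|; first by lia.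
  by move/dvdn_leq => /(_ d0); lia.
- have [d0|d0] := posnP `|(a%:Z + b%:Z)%R|; first by lia.
  by move/dvdn_leq => /(_ d0); lia.
Qed.

Section Halving.

Variables (T : finType) (s : {perm T}) (c : T -> nat) (M : nat).
Hypothesis c_inj : injective c.
Hypothesis c_lt : forall x, 2 * c x < M.
Hypothesis s_half : forall x, c x = 2 * c (s x) \/ c x + 2 * c (s x) = M.

(** Both cases of [s_half] say that [c x] is [2 * c (s x)] up to sign modulo [M]; the factors 2
    accumulate along the orbit. *)
Lemma eqpm_iter k x : eqpm M (c x) ((2 ^ k)%N%:Z * c ((s ^+ k)%g x))%R.
Proof.
elim: k => [|k IHk].
  by rewrite expg0 perm1 mul1r /eqpm subrr dvdz0.
apply: eqpm_trans IHk _; rewrite expnSr PoszM -mulrA; apply: eqpm_mull.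
rewrite expgSr permM /eqpm; set y := (s ^+ k)%g x.
apply/orP; case: (s_half y) => e; [left | right]; apply/dvdzP.
- by exists 0%R; lia.
- by exists 1%R; lia.
Qed.

Lemma halving_period r :
  0 < r -> (2 ^ r.-1).+1 < M -> eqpm M (2 ^ r)%N 1%N ->
  (exists x, c x = 1) -> is_period s r.
Proof.
move=> r_gt0 M_gt M_r [x1 cx1]; split=> // [|m m_gt0 sm].
  apply/permP => x; rewrite perm1; apply/c_inj/esym/(@eqpm_inj M) => //.
  apply: eqpm_trans (eqpm_iter r x) _.
  by rewrite mulrC -[X in eqpm _ _ X]mulr1; apply: eqpm_mull.
have := eqpm_iter m x1; rewrite sm perm1 cx1 mulr1 leqNgt.
move=> e; apply/negP => m_lt.
(* Since [2 <= 2 ^ m < M - 1], both [2 ^ m - 1] and [2 ^ m + 1] lie strictly between 0 and [M], so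
   [M] divides neither. *)
have le2 : 2 ^ m <= 2 ^ r.-1 by rewrite leq_exp2l //; lia.
have ge2 : 2 ^ 1 <= 2 ^ m by rewrite leq_exp2l.
case/orP: e; rewrite dvdzE => /dvdn_leq; lia.
Qed.

End Halving.

Lemma h1E n (x : 'I_(2 * n)) : (h1 n x).+1 = monge1 n x.+1.
Proof. exact: deck_permE. Qed.

Lemma h2E n (x : 'I_(2 * n)) : (h2 n x).+1 = monge2 n x.+1.
Proof. exact: deck_permE. Qed.

Lemma h3E n (x : 'I_(2 * n)) : (h3 n x).+1 = monge3 n x.+1.
Proof. exact: deck_permE. Qed.

Lemma h4E n (x : 'I_(2 * n)) : (h4 n x).+1 = monge4 n x.+1.
Proof. exact: deck_permE. Qed.

(* For p = 1 the permutations h2 and h4 of {1, 2} are the identity, of period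
   1; hence the restriction to p >= 2 for these two. *)
Theorem mainTheorem8 (p : nat) (hp : 1 <= p) :
  let n := 2 ^ (p - 1) in
  [/\ is_period (h1 n) (p + 1),
      2 <= p -> is_period (h2 n) (p + 1),
      is_period (h3 n) (p + 1)
    & 2 <= p -> is_period (h4 n) (p + 1)].
Proof.
move=> n.
have p1 : (p + 1).-1 = (p - 1).+1 by lia.
have e2 : 2 ^ (p + 1).-1 = 2 * n by rewrite p1 expnS.
have e4 : 2 ^ (p + 1) = 4 * n.
  by rewrite -(prednK (n := p + 1)) ?expnS ?e2; lia.
have n_gt0 : 0 < n by rewrite expn_gt0.
have n_gt1 : 2 <= p -> 1 < n by move=> p2; rewrite -(expn0 2) ltn_exp2l; lia.
have Mplus : eqpm (4 * n).+1 (2 ^ (p + 1))%N 1%N.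
  by rewrite e4; apply/orP; right; apply/dvdzP; exists 1%R; lia.
have Mminus : eqpm (4 * n).-1 (2 ^ (p + 1))%N 1%N.
  by rewrite e4; apply/orP; left; apply/dvdzP; exists 1%R; lia.
split=> [|/n_gt1 {}n_gt1||/n_gt1 {}n_gt1].
(* The card is [i = x.+1], with coordinate [2n + 1 - i]: its position counted from the other end of
   the deck, starting at 1. *)
- apply: (@halving_period _ _ (fun x : 'I_(2 * n) => 2 * n - x) (4 * n).+1);
    rewrite ?e2 //; try lia.
  + by move=> x y /=; have := ltn_ord x; have := ltn_ord y => *; apply: ord_inj; lia.
  + move=> x; have := h1E x; have := ltn_ord x; have := ltn_ord (h1 n x).
    by rewrite /monge1; move: (nat_of_ord x) (nat_of_ord _) => i j; case: ifP; lia.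
  + have lt : (2 * n).-1 < 2 * n by lia.
    by exists (Ordinal lt) => /=; lia.
(* Now the count from the other end starts at 0, the coordinate of the fixed card [2n]. The bound
   [2 ^ p + 1 < M] reads [2n + 1 < 4n - 1], that is [n > 1]. *)
- apply: (@halving_period _ _ (fun x : 'I_(2 * n) => (2 * n).-1 - x) (4 * n).-1);
    rewrite ?e2 //; try lia.
  + by move=> x y /=; have := ltn_ord x; have := ltn_ord y => *; apply: ord_inj; lia.
  + move=> x; have := h2E x; have := ltn_ord x; have := ltn_ord (h2 n x).
    by rewrite /monge2; move: (nat_of_ord x) (nat_of_ord _) => i j; case: ifP; lia.
  + have lt : (2 * n).-2 < 2 * n by lia.
    by exists (Ordinal lt) => /=; lia.
- apply: (@halving_period _ _ (fun x : 'I_(2 * n) => x.+1) (4 * n).+1);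
    rewrite ?e2 //; try lia.
  + by move=> x y [] /val_inj.
  + by move=> x /=; have := ltn_ord x; lia.
  + move=> x; have := h3E x; have := ltn_ord x; have := ltn_ord (h3 n x).
    by rewrite /monge3; move: (nat_of_ord x) (nat_of_ord _) => i j; case: ifP; lia.
  + have lt : 0 < 2 * n by lia.
    by exists (Ordinal lt).
(* The coordinate is [i - 1], so that the fixed card 1 sits at 0; the bound again amounts to
   [n > 1]. *)
- apply: (@halving_period _ _ (fun x : 'I_(2 * n) => nat_of_ord x) (4 * n).-1);
    rewrite ?e2 //; try lia.
  + exact: val_inj.
  + by move=> x /=; have := ltn_ord x; lia.
  + move=> x; have := h4E x; have := ltn_ord x; have := ltn_ord (h4 n x).
    by rewrite /monge4; move: (nat_of_ord x) (nat_of_ord _) => i j; case: ifP; lia.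
  + have lt : 1 < 2 * n by lia.
    by exists (Ordinal lt).
Qed.
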